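(* Let $n\ge2$ be an integer, let $b$ be a $q$-subline of $\mathrm{PG}(1,q^n)$, and $\Theta\not\in b$ a point of $\mathrm{PG}(1,q^n)$. Then in $\mathrm{PG}(2n-1,q)$ any $n$-dimensional subspace $\mathcal{H}$ containing $\mathcal{F}(\Theta)$ intersects the Segre variety $\mathcal{S}_{n-1,1,q}=\tilde{\mathcal{F}}(b)$ in a normal rational curve whose order is $\min\{q,[\Theta:b]\}$.
   Context: All dimensions are projective. $\mathcal{F}$ is the field reduction map: identify $\mathrm{PG}(2n-1,q)$ with the projective space of the $2n$-dimensional $\mathbb{F}_q$-vector space $\mathbb{F}_{q^n}^2$; for a point $P=\langle v\rangle_{\mathbb{F}_{q^n}}$ of $\mathrm{PG}(1,q^n)$, $\mathcal{F}(P)$ is the $(n-1)$-dimensional subspace $\{\langle\lambda v\rangle_{\mathbb{F}_q}:\lambda\in\mathbb{F}_{q^n}^*\}$. For a set $S$ of points, $\mathcal{F}(S)=\{\mathcal{F}(P):P\in S\}$ and $\tilde{\mathcal{F}}(S)$ is the set of points $\bigcup_{P\in S}\mathcal{F}(P)$. A $q$-subline of $\mathrm{PG}(1,q^n)$ is a set of $q+1$ points $\{\langle xu+yv\rangle_{\mathbb{F}_{q^n}} : (x,y)\in\mathbb{F}_q^2\setminus\{(0,0)\}\}$ with $u,v$ linearly independent over $\mathbb{F}_{q^n}$. For a $q$-subline $b$, $\mathcal{F}(b)$ is a regulus of $(n-1)$-dimensional subspaces, and $\tilde{\mathcal{F}}(b)$ is a Segre variety $\mathcal{S}_{n-1,1,q}$,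 i.e. projectively equivalent to the image of the Segre embedding of $\mathrm{PG}(n-1,q)\times\mathrm{PG}(1,q)$ in $\mathrm{PG}(2n-1,q)$. Degree of a point over a $q$-subline: for $\Theta\notin b$, $[\Theta:b]=[\mathbb{F}_q(\zeta):\mathbb{F}_q]$, where $(1,\zeta)$ are homogeneous coordinates of $\Theta$ with respect to a reference frame consisting of three points of $b$ (these receiving coordinates $(1,0),(0,1),(1,1)$); this does not depend on the frame. For $\Theta\in b$, $[\Theta:b]=1$. A normal rational curve of order $t$ is a set of points spanning a $t$-dimensional subspace and equal, in suitable homogeneous coordinates of that subspace, to $\{\langle(y_0^t,y_0^{t-1}y_1,\ldots,y_1^t)\rangle:(y_0,y_1)\in\mathbb{F}_q^2\setminus\{(0,0)\}\}$ (for $t=q$: a set of $q+1$ independent points). *)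

(* Defs.v *)
From HB Require Import structures.
From mathcomp Require Import all_boot all_order all_algebra all_field.
From mathcomp Require Import boolp classical_sets.

Set Implicit Arguments.
Unset Strict Implicit.
Unset Printing Implicit Defensive.

Import GRing.Theory.
Local Open Scope ring_scope.
Local Open Scope classical_set_scope.

(* Subspaces of PG(V) are given by their underlying vector subspaces, so a     *)
(* subspace of projective dimension d is a {vspace V} of dimension d.+1, and a *)
(* set of points is a set of one-dimensional {vspace V}.                       *)

Definition points (K : fieldType) (V : vectType K) (U : {vspace V}) :
    set {vspace V} :=
  [set P | \dim P = 1%N /\ (P <= U)%VS].

Definition spans (K : fieldType) (V : vectType K) (C : set {vspace V})
    (W : {vspace V}) : Prop :=
  (forall P, C P -> (P <= W)%VS) /\
  (forall U : {vspace V}, (forall P, C P -> (P <= U)%VS) -> (W <= U)%VS).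

(* Homogeneous coordinates of the subspace W are those given by a basis e.     *)
Definition normal_rational_curve (K : fieldType) (V : vectType K) (t : nat)
    (C : set {vspace V}) : Prop :=
  exists W : {vspace V}, [/\ \dim W = t.+1, spans C W &
    exists2 e : t.+1.-tuple V, basis_of W e &
      C = [set P | exists2 y : K * K, y != (0, 0) &
             P = <[\sum_(i < t.+1)
                    (y.1 ^+ (t - i) * y.2 ^+ i) *: tnth e i]>%VS]].

Section FieldReduction.
Variables (F : finFieldType) (L : fieldExtType F).

(* The underlying set L * L carries two vector space structures: over L it is  *)
(* [plane], whose projective space is PG(1, q ^ n), and over F it is           *)
(* [reduced_space], whose projective space is PG(2 n - 1, q).                  *)
Definition plane : vectType L := (L^o * L^o)%type.
Definition reduced_space : vectType F := (L * L)%type.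

Definition mulvec (v : plane) (l : L) : reduced_space := (l * v.1, l * v.2).

(* For a point P of PG(1, q ^ n), vpick P is a nonzero vector of P, and the    *)
(* result does not depend on it, see mem_field_reduction.                      *)
Definition field_reduction (P : {vspace plane}) : {vspace reduced_space} :=
  limg (linfun (mulvec (vpick P))).

Definition field_reduction_points (S : set {vspace plane}) :
    set {vspace reduced_space} :=
  \bigcup_(P in S) points (field_reduction P).

Definition subline (b : set {vspace plane}) : Prop :=
  exists u v : plane, free [:: u; v] /\
    b = [set P | exists2 x : F * F, x != (0, 0) &
           P = <[(x.1%:A : L) *: u + (x.2%:A : L) *: v]>%VS].

(* (1, z) are homogeneous coordinates of T with respect to a frame in b: the   *)
(* frame points <u>, <v>, <u + v> have coordinates (1, 0), (0, 1), (1, 1).     *)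
Definition frame_coordinate (b : set {vspace plane}) (T : {vspace plane})
    (z : L) : Prop :=
  exists u v : plane,
    [/\ free [:: u; v], b <[u]>%VS, b <[v]>%VS, b <[u + v]>%VS &
        T = <[u + z *: v]>%VS].

Definition degree_over (T : {vspace plane}) (b : set {vspace plane}) : nat :=
  if `[< b T >] then 1%N
  else adjoin_degree 1%AS (xget 0 (frame_coordinate b T)).

Lemma mulvec_linear (v : plane) : linear (mulvec v).
Proof.
by move=> a x y; congr pair; rewrite /= mulrDl -scalerAl.
Qed.

HB.instance Definition _ (v : plane) :=
  GRing.isLinear.Build F L reduced_space *:%R (mulvec v) (mulvec_linear v).

Lemma mem_field_reduction (P : {vspace plane}) (w : L * L) :
  \dim P = 1%N -> (w \in field_reduction P) = ((w : plane) \in P).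
Proof.
move=> dP; pose v := vpick P.
have v0 : v != 0 by rewrite vpick0 -dimv_eq0 dP.
have PE : P = <[v]>%VS.
  by apply/esym/eqP; rewrite eqEdim -memvE memv_pick dim_vline v0 dP.
apply/memv_imgP/idP => [[l _ ->]|].
  by rewrite lfunE {2}PE; apply/vlineP; exists l.
rewrite {1}PE => /vlineP[l wE].
by exists l; rewrite ?memvf // lfunE.
Qed.

End FieldReduction.

(* Main.v *)
Require Import Defs.
From HB Require Import structures.
From mathcomp Require Import all_boot all_order all_algebra all_field.
From mathcomp Require Import boolp classical_sets.
From mathcomp Require Import ring zify.
Set Implicit Arguments.
Unset Strict Implicit.
Unset Printing Implicit Defensive.
Import GRing.Theory.
Local Open Scope ring_scope.
Local Open Scope classical_set_scope.

(** Fix a frame u, v of the subline with Theta = <u + z v>, where z lies outside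
F because Theta is not in b.  A vector a u + b v lies in the reduction of Theta
exactly when b - z a = 0, so a subspace H of one more dimension containing that
reduction is { a u + b v : b - z a in F h } for some nonzero h
([section_equation]).  A vector l (y1 u + y2 v) of the Segre variety, with (y1, y2) over F, is therefore
in H iff l (y2 - z y1) is in F h: each point (y1, y2) of the projective line
over F contributes exactly one point of H, spanned by
          h / (y2 - z y1) . (y1 u + y2 v).
It remains to clear the denominator by factors from F, the only ones that keep
the projective point, and to reach forms of degree t = min (q, [F(z) : F]).

Let p be a monic polynomial over F of degree t without roots in F, and N its
homogenization; N takes nonzero values in F away from (0, 0).  When p is the minimal polynomial of
z, N is divisible over L by y2 - z y1, so N / (y2 - z y1) is a form of degree
t - 1 whose coefficients are the Horner quotients of p at z
([homogeneous_quotient]), and multiplying the vector above by N gives forms of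
degree t.  When q <= [F(z) : F], one takes p = X^q - X + 1, which has the value
1 on all of F: as a function on F x F, the defect y1^(t+1) p(z) of divisibility
is then proportional to y1 N, and a scalar of L corrects it.  The common
property is the last clause of [nonvanishing_form_exists].

The t + 1 coefficient vectors are independent because the Horner quotients of p
have pairwise different degrees, all less than [F(z) : F]
([drop_poly_free], [small_root_eq0]), and they are in the span of the points
because t <= q, by a Vandermonde determinant ([rational_curve_spans]).  Finally
the degree of Theta over b is computed from an arbitrary frame, and any frame
of b parametrizes b in the same way ([subline_through_frame]). *)

(** * Binary forms and their quotient by a linear factor *)

Definition homogeneous (R : nzRingType) (p : {poly R}) (t : nat) (x y : R) : R :=
  \sum_(i < t.+1) p`_i * (x ^+ (t - i) * y ^+ i).

Lemma drop_poly_horner (R : comNzRingType) (p : {poly R}) (i : nat) (z : R) :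
  (drop_poly i p).[z] = p`_i + z * (drop_poly i.+1 p).[z].
Proof.
rewrite -{1}(poly_take_drop 1 (drop_poly i p)) hornerD hornerM hornerX mulrC.
have -> : drop_poly 1 (drop_poly i p) = drop_poly i.+1 p.
  by apply/polyP=> j; rewrite !coefE addn1 addSnnS.
have -> : take_poly 1 (drop_poly i p) = (p`_i)%:P.
  by apply/polyP=> j; rewrite !coefE; case: j.
by rewrite hornerC.
Qed.

(** The Horner scheme, homogenized.  Evaluating the successive quotients
[drop_poly i.+1 p] at z gives the coefficients of the quotient of p - p(z) by
X - z.  The sum is x times the homogenized quotient, hence a form of degree t whose
term at i = t is zero. *)
Lemma homogeneous_quotient (R : comNzRingType) (p : {poly R}) (t : nat)
    (x y z : R) : (size p <= t.+1)%N ->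
  (\sum_(i < t.+1) (drop_poly i.+1 p).[z] * (x ^+ (t - i) * y ^+ i))
     * (y - z * x)
  = x * homogeneous p t x y - x ^+ t.+1 * p.[z].
Proof.
move=> sp; set q := fun i => (drop_poly i p).[z].
have q0 : q 0%N = p.[z] by rewrite /q drop_poly0l.
have qt : q t.+1 = 0 by rewrite /q drop_poly_eq0 ?horner0.
pose g i := q i * (x ^+ (t.+1 - i) * y ^+ i).
(* With q_i = p_i + z q_(i+1), consecutive terms telescope. *)
have tele : \sum_(i < t.+1) (g i.+1 - g i) = g t.+1 - g 0%N.
  by rewrite -(big_mkord xpredT (fun i => g i.+1 - g i)) telescope_sumr.
have gt : g t.+1 - g 0%N = - (x ^+ t.+1 * p.[z]).
  by rewrite /g qt q0 mul0r sub0r subn0 expr0 mulr1 mulrC.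
rewrite -gt -tele /homogeneous mulr_sumr -big_split mulr_suml /=.
apply: eq_bigr => i _; rewrite -/(q i.+1) /g.
have -> : p`_i = q i - z * q i.+1 by rewrite /q drop_poly_horner addrK.
by rewrite subSS subSn -1?ltnS // !exprS; ring.
Qed.

Lemma homogeneous_horner (K : fieldType) (p : {poly K}) (t : nat) (x y : K) :
  (size p <= t.+1)%N -> x != 0 -> homogeneous p t x y = x ^+ t * p.[y / x].
Proof.
move=> sp x0; rewrite (horner_coef_wide _ sp) mulr_sumr; apply: eq_bigr => i _.
have it : (i <= t)%N by rewrite -ltnS.
have -> : x ^+ t = x ^+ (t - i) * x ^+ i by rewrite -exprD subnK.
have -> : y ^+ i = x ^+ i * (y / x) ^+ i by rewrite -exprMn mulrCA divff ?mulr1.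
by ring.
Qed.

Lemma homogeneous0 (K : fieldType) (p : {poly K}) (t : nat) (y : K) :
  homogeneous p t 0 y = p`_t * y ^+ t.
Proof.
rewrite /homogeneous big_ord_recr /= subnn expr0 mul1r big1 ?add0r // => i _.
by rewrite expr0n subn_eq0 leqNgt ltn_ord mul0r mulr0.
Qed.

Lemma homogeneous_map (K : fieldType) (L : fieldExtType K) (p : {poly K}) t x y :
  homogeneous (map_poly (in_alg L) p) t (x%:A) (y%:A) = (homogeneous p t x y)%:A.
Proof.
rewrite -[RHS]in_algE /homogeneous rmorph_sum; apply: eq_bigr => i _.
by rewrite coef_map !rmorphM !rmorphXn.
Qed.

Lemma homogeneous_neq0 (K : fieldType) (p : {poly K}) (t : nat) (y : K * K) :
  p \is monic -> size p = t.+1 -> (forall c, ~~ root p c) -> y != (0, 0) ->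
  homogeneous p t y.1 y.2 != 0.
Proof.
case: y => a b /= pm sp nr; have [->|a0] := eqVneq a 0 => yn.
  rewrite homogeneous0; have -> : p`_t = 1 by rewrite -(eqP pm) lead_coefE sp.
  by rewrite mul1r expf_eq0 negb_and; apply/orP; right; apply: contra yn => /eqP->.
by rewrite homogeneous_horner ?sp // mulf_neq0 ?expf_neq0 ?nr //.
Qed.

(** * A polynomial without roots in the base field *)

Section Form.
Variables (F : finFieldType) (L : fieldExtType F).
Implicit Type z : L.

Local Notation "p ^L" := (map_poly (in_alg L) p) (at level 2, format "p ^L").

Lemma small_root_eq0 (p : {poly F}) z :
  (size p <= adjoin_degree 1%AS z)%N -> root p^L z -> p = 0.
Proof.
move=> sp; rewrite (@root_small_adjoin_poly _ _ 1%AS) ?map_poly_eq0; first by move/eqP.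
- by apply/polyOver1P; exists p.
- by rewrite size_map_poly.
Qed.

(** A root in F would split off a linear factor, and the cofactor would be a
polynomial of smaller degree that vanishes at z. *)
Lemma minPoly_form z : z \notin 1%VS -> exists p : {poly F},
  [/\ p \is monic, size p = (adjoin_degree 1%AS z).+1,
      forall c, ~~ root p c & root p^L z].
Proof.
move=> zF; have /polyOver1P[p pE] := minPolyOver 1%AS z.
have sp : size p = (adjoin_degree 1%AS z).+1.
  by rewrite -(size_map_poly (in_alg L)) -pE size_minPoly.
exists p; split=> //; last by rewrite -pE root_minPoly.
  by have := monic_minPoly 1%AS z; rewrite pE monicE lead_coef_map fmorph_eq1.
move=> c; apply/negP => /factor_theorem[r rE].
have : root p^L z by rewrite -pE root_minPoly.
rewrite rE rmorphM rootM /= => /orP[rz|]; last first.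
  rewrite rmorphB /= map_polyX map_polyC /= root_XsubC => /eqP zE.
  by case/negP: zF; rewrite zE rpredZ ?rpred1.
have r0 : r != 0 by apply: contraL zF => r0; move: sp; rewrite rE (eqP r0) mul0r size_poly0.
case/eqP: (r0); apply: (small_root_eq0 _ rz).
by move: sp; rewrite rE size_Mmonic ?monicXsubC // size_XsubC addn2 => -[->].
Qed.

(** X^q - X already has its q roots in F. *)
Lemma frobenius_fixed z : z ^+ #|F| = z -> z \in 1%VS.
Proof.
move=> zq; have := congr1 (fun p => p^L.[z]) (finField_genPoly F).
rewrite rmorphB rmorphXn /= map_polyX hornerD hornerN hornerXn hornerX zq subrr.
rewrite rmorph_prod horner_prod => /esym/eqP/prodf_eq0[c _].
rewrite rmorphB /= map_polyX map_polyC hornerXsubC subr_eq0 => /eqP->.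
by rewrite rpredZ ?rpred1.
Qed.

(** The last clause says that the scalar k turns the values of p - p(z), which is
divisible by X - z, into those of p, on F only: k = 1 for the minimal polynomial,
which vanishes at z, whereas p - p(z) and p are both constant on F for
p = X^q - X + 1. *)
Lemma nonvanishing_form_exists z : z \notin 1%VS ->
  let t := minn #|F| (adjoin_degree 1%AS z) in
  exists (p : {poly F}) (k : L),
  [/\ p \is monic, size p = t.+1, forall c, ~~ root p c, k != 0 &
      forall c : F, k * ((p.[c])%:A - p^L.[z]) = (p.[c])%:A].
Proof.
move=> zF t; have q1 : (1 < #|F|)%N := finNzRing_gt1 F.
have [qm|mq] := leqP #|F| (adjoin_degree 1%AS z); last first.
  have [p [pm sp nr /eqP rz]] := minPoly_form zF.
  exists p, 1; rewrite oner_neq0 /t (minn_idPr (ltnW mq)); split=> // c.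
  by rewrite mul1r rz subr0.
pose p : {poly F} := 'X^#|F| + (1 - 'X).
have s1 : (size (1 - 'X : {poly F})%R < size ('X^#|F| : {poly F}))%N.
  by rewrite -opprB size_polyN size_XsubC size_polyXn ltnS.
have pc c : p.[c] = 1.
  by rewrite hornerD hornerXn expf_card hornerD hornerN hornerX hornerC addrC subrK.
have pz : p^L.[z] = 1 + (z ^+ #|F| - z).
  rewrite rmorphD rmorphB rmorphXn rmorph1 /= map_polyX hornerD hornerXn hornerD hornerN hornerX hornerC; ring.
have d0 : z - z ^+ #|F| != 0.
  by rewrite subr_eq0 eq_sym; apply: contra zF => /eqP/frobenius_fixed.
exists p, (z - z ^+ #|F|)^-1; rewrite /t (minn_idPl qm); split.
- by rewrite monicE lead_coefDl // lead_coefXn.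
- by rewrite size_polyDl // size_polyXn.
- by move=> c; rewrite rootE pc oner_eq0.
- by rewrite invr_eq0.
- move=> c; rewrite pc pz scale1r opprD addNKr opprB mulVf //.
Qed.
End Form.

(** * Independence and spanning *)

Section Spanning.

(** The polynomials [drop_poly i.+1 p] for i < t have the distinct degrees
t.-1 - i; reading off the leading terms from i = 0 on kills the coefficients one
after the other. *)
Lemma drop_poly_free (K : fieldType) (p : {poly K}) (t : nat) (c : nat -> K) :
  size p = t.+1 -> \sum_(i < t) c i *: drop_poly i.+1 p = 0 ->
  forall i, (i < t)%N -> c i = 0.
Proof.
move=> sp c0; have pt : p`_t != 0.
  by have := lead_coef_eq0 p; rewrite lead_coefE sp /= => ->; rewrite -size_poly_eq0 sp.
elim/ltn_ind => i IHi it; have := congr1 (fun r : {poly K} => r`_(t.-1 - i)) c0.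
rewrite coef0 coef_sum (bigD1 (Ordinal it)) //= big1 => [|j ji]; last first.
  rewrite coefZ coef_drop_poly; have [lji|] := ltnP j i.
    by rewrite IHi ?mul0r // (ltn_trans lji).
  rewrite leq_eqVlt eq_sym => /orP[/eqP jE|lij].
    by case/eqP: ji; apply: val_inj.
  by rewrite [p`_ _]nth_default ?mulr0 // sp; case: (t) it j lij {ji} => //= s it j lij; lia.
rewrite addr0 coefZ coef_drop_poly.
have -> : (t.-1 - i + i.+1)%N = t by lia.
by move/eqP; rewrite mulf_eq0 (negPf pt) orbF => /eqP.
Qed.

(** Inverting a Vandermonde matrix on t elements of F recovers each e_i from the
points of the curve. *)
Lemma moment_curve_spans (F : finFieldType) (V : vectType F) (t : nat)
    (e : 'I_t -> V) (U : {vspace V}) : (t <= #|F|)%N ->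
  (forall c : F, \sum_(i < t) c ^+ i *: e i \in U) -> forall i, e i \in U.
Proof.
move=> tq eU j.
pose a : 'rV[F]_t := \row_k enum_val (widen_ord tq k).
pose M := Vandermonde t a.
have uM : M \in unitmx.
  rewrite unitmxE unitfE det_Vandermonde; apply/prodf_neq0 => k _.
  apply/prodf_neq0 => l kl; rewrite !mxE subr_eq0.
  apply/eqP => /enum_val_inj/(congr1 val) /= lk; by rewrite lk ltnn in kl.
have -> : e j = \sum_(k < t) invmx M k j *: \sum_(i < t) a 0 k ^+ i *: e i.
  under eq_bigr do rewrite scaler_sumr.
  rewrite exchange_big /=.
  transitivity (\sum_(i < t) (M *m invmx M) i j *: e i).
    rewrite mulmxV // (bigD1 j) //= mxE eqxx scale1r big1 ?addr0 // => i ij.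
    by rewrite mxE (negPf ij) scale0r.
  apply: eq_bigr => i _; rewrite mxE scaler_suml; apply: eq_bigr => k _.
  by rewrite scalerA mxE mulrC.
by apply: memv_suml => k _; rewrite memvZ.
Qed.

(** The q affine points only suffice for t vectors; when t = q the point (0, 1)
supplies the last one. *)
Lemma rational_curve_spans (F : finFieldType) (V : vectType F) (t : nat)
    (e : 'I_t.+1 -> V) (U : {vspace V}) : (t <= #|F|)%N ->
  (forall y : F * F, y != (0, 0) ->
     \sum_(i < t.+1) (y.1 ^+ (t - i) * y.2 ^+ i) *: e i \in U) ->
  forall i, e i \in U.
Proof.
move=> tq eU.
have et : e ord_max \in U.
  have := eU (0, 1); rewrite xpair_eqE oner_eq0 andbF big_ord_recr /= => /(_ isT).
  rewrite subnn expr0 expr1n mul1r scale1r big1 ?add0r // => i _.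
  by rewrite expr0n subn_eq0 leqNgt ltn_ord mul0r scale0r.
have low (i : 'I_t) : e (widen_ord (leqnSn t) i) \in U.
  apply: (moment_curve_spans tq (e := fun i => e (widen_ord (leqnSn t) i))) => c.
  have := eU (1, c); rewrite xpair_eqE oner_eq0 big_ord_recr /= => /(_ isT).
  rewrite rpredDr ?memvZ //; congr (_ \in U); apply: eq_bigr => k _.
  by rewrite expr1n mul1r.
move=> i; have [it|ti] := ltnP i t.
  by rewrite (_ : i = widen_ord (leqnSn t) (Ordinal it)) //; apply: val_inj.
rewrite (_ : i = ord_max) //; apply: val_inj; apply/eqP.
by rewrite eqn_leq ti -ltnS ltn_ord.
Qed.
End Spanning.

(** * Coordinates with respect to a frame *)

Section Coordinates.
Variables (F : finFieldType) (L : fieldExtType F).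
Implicit Types (u v w : plane L) (a b z h : L).

Definition subline_through u v : set {vspace plane L} :=
  [set P | exists2 x : F * F, x != (0, 0) &
     P = <[(x.1%:A : L) *: u + (x.2%:A : L) *: v]>%VS].

(** The vector a u + b v, written so that it is visibly F-linear in (a, b). *)
Definition reduced_comb u v a b : reduced_space L := mulvec u a + mulvec v b.

Lemma reduced_combE u v a b : reduced_comb u v a b = a *: u + b *: v.
Proof. by []. Qed.

Lemma free2P u v : reflect (forall a b, a *: u + b *: v = 0 -> a = 0 /\ b = 0)
  (free [:: u; v]).
Proof.
apply: (iffP (freeP (X := in_tuple [:: u; v]))) => [uv a b abE|uv k].
  have /= E := uv (fun i : 'I_2 => if i == 0 then a else b).
  rewrite big_ord_recl big_ord1 /= in E.
  by have {}E := E abE; split; [have := E 0|have := E 1].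
rewrite big_ord_recl big_ord1 /= => /uv[k0 k1] i.
by case: i => [[|[|//]] ilt]; [rewrite -k0|rewrite -k1]; congr (k _); apply: val_inj.
Qed.

Lemma free2_inj u v a b a' b' : free [:: u; v] ->
  a *: u + b *: v = a' *: u + b' *: v -> a = a' /\ b = b'.
Proof.
move=> /free2P uv /eqP; rewrite -subr_eq0 opprD addrACA -!scalerBl => /eqP/uv[].
by move=> /eqP; rewrite subr_eq0 => /eqP-> /eqP; rewrite subr_eq0 => /eqP->.
Qed.

Lemma free2_span u v w : free [:: u; v] -> exists a b, w = a *: u + b *: v.
Proof.
move=> uv; have /andP[/eqP uvT _] : basis_of {:plane L} [:: u; v].
  by rewrite basisEfree uv subvf /= dimvf.
have : w \in <<[:: u; v]>>%VS by rewrite uvT memvf.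
rewrite span_cons span_seq1 => /memv_addP[x /vlineP[a ->] [y /vlineP[b ->] ->]].
by exists a, b.
Qed.

Lemma free2_neq0 u v (x : F * F) : free [:: u; v] -> x != (0, 0) ->
  (x.1%:A : L) *: u + (x.2%:A : L) *: v != 0.
Proof.
case: x => x y /free2P uv; apply: contra => /eqP/uv[/= /eqP + /eqP].
by rewrite !scaler_eq0 oner_eq0 !orbF => /eqP-> /eqP->.
Qed.

Lemma field_reduction_line w (x : L * L) : w != 0 ->
  reflect (exists l : L, x = l *: w) (x \in field_reduction <[w]>%VS).
Proof.
move=> w0; rewrite mem_field_reduction ?dim_vline ?w0 //.
by apply: (iffP (@vlineP _ (plane L) x w)).
Qed.

Lemma dim_field_reduction (P : {vspace plane L}) : \dim P = 1%N ->
  \dim (field_reduction P) = \dim {:L}.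
Proof.
move=> dP; apply: limg_dim_eq; apply/eqP; rewrite -subv0; apply/subvP => l.
rewrite memv_cap memvf memv_ker lfunE memv0 /= => /eqP lv.
have : l *: vpick P == 0 by apply/eqP.
by rewrite scaler_eq0 vpick0 -dimv_eq0 dP orbF.
Qed.

(** The map a u + b v |-> b - z a has the reduction of <u + z v> as its kernel, and
H / kernel is an F-line. *)
Lemma section_equation u v z (H : {vspace reduced_space L}) :
  free [:: u; v] -> \dim H = (\dim {:L}).+1 ->
  (field_reduction <[u + z *: v]> <= H)%VS ->
  exists2 h : L, h != 0 &
    forall a b, reduced_comb u v a b \in H <-> exists c : F, b - z * a = c *: h.
Proof.
move=> uv dH TH; have T0 : u + z *: v != 0.
  apply: contraL (uv) => /eqP T0; apply/negP => /free2P/(_ 1 z).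
  by rewrite scale1r T0 => /(_ erefl)[/eqP]; rewrite oner_eq0.
have TE a b : (reduced_comb u v a b \in field_reduction <[u + z *: v]>) = (b == z * a).
  apply/(field_reduction_line _ T0)/eqP => [[l]|->].
    rewrite reduced_combE scalerDr scalerA => /(free2_inj uv)[-> ->].
    exact: mulrC.
  by exists a; rewrite scalerDr scalerA mulrC.
have [w wH wT] : exists2 w, w \in H & w \notin field_reduction <[u + z *: v]>.
  apply/subvPn/negP => /dimvS; rewrite dH dim_field_reduction ?ltnn //.
  by rewrite dim_vline T0.
have HE : H = (field_reduction <[u + z *: v]> + <[w]>)%VS.
  apply/esym/eqP; rewrite eqEdim subv_add TH -memvE wH dH addvC.
  rewrite -(dim_field_reduction (P := <[u + z *: v]>%VS)) ?dim_vline ?T0 //.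
  rewrite addvC ltnNge; apply: contra wT => le.
  have /eqP-> : field_reduction <[u + z *: v]> == (field_reduction <[u + z *: v]> + <[w]>)%VS.
    by rewrite eqEdim addvSl.
  by rewrite memvE addvSr.
have [a0 [b0 w0]] := free2_span (w : plane L) uv.
have {}w0 : w = reduced_comb u v a0 b0 by [].
exists (b0 - z * a0) => [|a b]; first by rewrite subr_eq0 -TE -w0.
have subE (c : F) : reduced_comb u v a b - c *: w =
    reduced_comb u v (a - c *: a0) (b - c *: b0).
  by rewrite w0 /reduced_comb scalerDr opprD addrACA !linearB !linearZ.
have memE (c : F) : (reduced_comb u v a b - c *: w \in field_reduction <[u + z *: v]>)
   = (b - z * a == c *: (b0 - z * a0)).
  rewrite subE TE -subr_eq0 -[RHS]subr_eq0 scalerBr mulrBr -scalerAr; congr (_ == 0); ring.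
rewrite HE; split=> [/memv_addP[x xT [y /vlineP[c ->] xE]]|[c /eqP]].
  by exists c; apply/eqP; rewrite -memE xE addrK.
rewrite -memE => xT; rewrite -[X in X \in _](subrK (c *: w)).
by rewrite memv_add ?memvZ ?memv_line.
Qed.

End Coordinates.

(** * The section is a rational normal curve *)

Section Curve.
Variables (F : finFieldType) (L : fieldExtType F).
Implicit Types (u v w : plane L) (z h : L).

Local Notation "p ^L" := (map_poly (in_alg L) p) (at level 2, format "p ^L").

Lemma denominator_neq0 z (y : F * F) : z \notin 1%VS -> y != (0, 0) ->
  y.2%:A - z * y.1%:A != 0 :> L.
Proof.
case: y => y1 y2 /= zF; have [->|y10] := eqVneq y1 0.
  by rewrite xpair_eqE eqxx /= scale0r mulr0 subr0 scaler_eq0 oner_eq0 orbF.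
move=> _; rewrite subr_eq0; apply: contra zF => /eqP zE.
have -> : z = (y1^-1 * y2)%:A.
  by rewrite -scalerA zE -scalerAr mulr1 scalerA mulVf // scale1r.
by rewrite rpredZ ?rpred1.
Qed.

Lemma map_drop_poly (p : {poly F}) i : (drop_poly i p)^L = drop_poly i p^L.
Proof. by apply/polyP => j; rewrite !(coef_map, coef_drop_poly). Qed.

Lemma scale_plane (c : F) (w : reduced_space L) :
  c *: w = (c%:A : L) *: (w : plane L).
Proof. by case: w => w1 w2; congr pair; apply/esym/mulr_algl. Qed.

(** The curve vectors are e_i = h (a_i u + b_i v) with b_i - z a_i = p_i in F, so
that every F-combination of them lies in H; P y is then N(y) times the intersection point attached to
y, because the sum of the a_i y1^(t-i) y2^i is N(y) y1 / (y2 - z y1). *)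
Lemma section_rational u v z h (H : {vspace reduced_space L}) :
  free [:: u; v] -> z \notin 1%VS -> h != 0 ->
  (forall a b, reduced_comb u v a b \in H <-> exists c : F, b - z * a = c *: h) ->
  normal_rational_curve (minn #|F| (adjoin_degree 1%AS z))
    (points H `&` field_reduction_points (subline_through u v)).
Proof.
move=> uv zF h0 HE; have := nonvanishing_form_exists zF.
set t := minn _ _ => -[p [k [pm sp nr k0 pk]]].
have tF : (t <= #|F|)%N by exact: geq_minl.
have tm : (t <= adjoin_degree 1%AS z)%N by exact: geq_minr.
clearbody t.
pose a i := k * (drop_poly i.+1 p^L).[z].
pose b i := (p`_i)%:A + z * a i.
pose e (i : 'I_t.+1) := reduced_comb u v (h * a i) (h * b i).
pose N (y : F * F) := homogeneous p t y.1 y.2.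
pose den (y : F * F) : L := y.2%:A - z * y.1%:A.
pose P (y : F * F) := \sum_(i < t.+1) (y.1 ^+ (t - i) * y.2 ^+ i) *: e i.
have algM (x y : F) : (x * y)%:A = x%:A * y%:A :> L by exact: (rmorphM (in_alg L)).
have algX (x : F) i : (x ^+ i)%:A = x%:A ^+ i :> L by exact: (rmorphXn (in_alg L)).
have N0 y : y != (0, 0) -> N y != 0 by exact: homogeneous_neq0.
have aE (y : F * F) :
    (\sum_(i < t.+1) (y.1 ^+ (t - i) * y.2 ^+ i) *: a i) * den y = N y *: y.1%:A.
  have -> : \sum_(i < t.+1) (y.1 ^+ (t - i) * y.2 ^+ i) *: a i =
      k * \sum_(i < t.+1) (drop_poly i.+1 p^L).[z] * (y.1%:A ^+ (t - i) * y.2%:A ^+ i).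
    rewrite mulr_sumr; apply: eq_bigr => i _; rewrite /a -[LHS]mulr_algl.
    by rewrite algM !algX mulrC -mulrA.
  (* The property of k is needed at y2 / y1; at y1 = 0 both sides vanish. *)
  rewrite -mulrA homogeneous_quotient ?size_map_poly ?sp // homogeneous_map.
  have [y0|y0] := eqVneq y.1 0.
    by rewrite y0 !scale0r exprS !mul0r subrr mulr0 scaler0.
  rewrite -/(N y) /N homogeneous_horner ?sp //.
  rewrite -[RHS]mulr_algl algM algX.
  move: (pk (y.2 / y.1)); move: (p^L.[z]) (_%:A : L) (y.1%:A : L) => pz pc x {}pk.
  transitivity (x ^+ t.+1 * (k * (pc - pz))).
    by rewrite exprS; ring.
  by rewrite pk exprS; ring.
have combE (c : 'I_t.+1 -> F) : \sum_(i < t.+1) c i *: e i =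
    reduced_comb u v (h * \sum_(i < t.+1) c i *: a i)
      (h * ((\sum_(i < t.+1) p`_i * c i)%:A + z * \sum_(i < t.+1) c i *: a i)).
  have -> : (\sum_(i < t.+1) p`_i * c i)%:A + z * \sum_(i < t.+1) c i *: a i =
      \sum_(i < t.+1) c i *: b i.
    rewrite mulr_sumr -[X in X + _]in_algE rmorph_sum -big_split; apply: eq_bigr => i _.
    by rewrite /b scalerDr -scalerAr scalerA [c i * _]mulrC.
  rewrite /reduced_comb !mulr_sumr !linear_sum -big_split; apply: eq_bigr => i _.
  by rewrite /e /reduced_comb scalerDr -!scalerAr !linearZ.
have PE y : y != (0, 0) ->
    P y = (h * (N y)%:A / den y) *: ((y.1%:A : L) *: u + (y.2%:A : L) *: v).
  move=> yn; have d0 : den y != 0 by exact: denominator_neq0.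
  rewrite [P y]combE -/(homogeneous p t y.1 y.2) -/(N y).
  have -> : \sum_(i < t.+1) (y.1 ^+ (t - i) * y.2 ^+ i) *: a i = (N y)%:A * y.1%:A / den y.
    by rewrite mulr_algl -aE mulfK.
  rewrite reduced_combE scalerDr !scalerA.
  set r := h * (N y)%:A / den y.
  have -> : h * ((N y)%:A * y.1%:A / den y) = r * y.1%:A by rewrite /r; ring.
  have -> // : h * ((N y)%:A + z * ((N y)%:A * y.1%:A / den y)) = r * y.2%:A.
  rewrite -[y.2%:A](subrK (z * y.1%:A)) -/(den y) [RHS]mulrDr /r divfK //; ring.
have P_neq0 y : y != (0, 0) -> P y != 0.
  move=> yn; rewrite PE //; apply/negP => /eqP Py0.
  have : (h * (N y)%:A / den y) *: ((y.1%:A : L) *: u + (y.2%:A : L) *: v) == 0.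
    exact/eqP.
  rewrite scaler_eq0 (negPf (free2_neq0 uv yn)) orbF !mulf_eq0 invr_eq0 (negPf h0).
  by rewrite scaler_eq0 oner_eq0 orbF (negPf (N0 _ yn)) (negPf (denominator_neq0 _ _)).
have e_free : free [tuple e i | i < t.+1].
  apply/freeP => c.
  have -> : \sum_(i < t.+1) c i *: [tuple e i | i < t.+1]`_i = \sum_(i < t.+1) c i *: e i.
    by apply: eq_bigr => i _; rewrite -tnth_nth tnth_mktuple.
  (* The u-coordinate is a relation between Horner quotients, and a_t = 0; once
     the other coefficients vanish, the v-coordinate is c_t p_t = c_t. *)
  rewrite combE => /(free2P _ _ uv)[/eqP + /eqP]; rewrite !mulf_eq0 (negPf h0) /=.
  move=> /eqP ca0; rewrite ca0 mulr0 addr0 scaler_eq0 oner_eq0 orbF => /eqP cp0.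
  have low i : (i < t)%N -> c (inord i) = 0.
    apply: (drop_poly_free (c := fun i => c (inord i)) sp).
    apply: (@small_root_eq0 _ _ _ z).
      apply: leq_trans tm.
      apply: (leq_trans (size_sum _ _ _)); apply/bigmax_leqP => j _.
      by rewrite (leq_trans (size_scale_leq _ _)) // size_drop_poly sp subSS leq_subr.
    rewrite rootE rmorph_sum horner_sum; move/eqP: ca0.
    rewrite big_ord_recr /= {2}/a drop_poly_eq0 ?size_map_poly ?sp // horner0 mulr0 scaler0 addr0.
    move=> /eqP ca0; apply/eqP/(mulfI k0); rewrite mulr0 -[RHS]ca0 mulr_sumr.
    apply: eq_bigr => j _; rewrite map_polyZ hornerZ map_drop_poly /= mulr_algl -scalerAr.
    by congr (c _ *: _); apply: val_inj; rewrite /= inordK // ltnS ltnW.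
  move: cp0; rewrite big_ord_recr big1 /= => [|i _]; last first.
    by rewrite -[widen_ord _ i]inord_val low ?mulr0 //= ltn_ord.
  have -> : p`_t = 1 by rewrite -(eqP pm) lead_coefE sp.
  rewrite add0r mul1r => ct i; have [it|ti] := ltnP i t.
    by rewrite -[i]inord_val low.
  rewrite (_ : i = ord_max) //; apply: val_inj; apply/eqP.
  by rewrite eqn_leq ti -ltnS ltn_ord.
have CE : points H `&` field_reduction_points (subline_through u v) =
    [set Q | exists2 y : F * F, y != (0, 0) & Q = <[P y]>%VS].
  apply/seteqP; split=> [Q [[dQ QH] [_ [y yn ->] [_ QT]]]|_ [y yn ->]].
    have xy0 := free2_neq0 uv yn.
    set w := vpick Q; have wQ : w \in Q by exact: memv_pick.
    have w0 : w != 0 by rewrite vpick0 -dimv_eq0 dQ.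
    have QE : Q = <[w]>%VS.
      by apply/esym/eqP; rewrite eqEdim -memvE wQ dim_vline w0 dQ.
    have /(field_reduction_line _ xy0)[l wE] := subvP QT _ wQ.
    (* w = l (y1 u + y2 v) in H forces l (y2 - z y1) = c h. *)
    have := subvP QH _ wQ; rewrite wE scalerDr !scalerA -reduced_combE => /HE[c cE].
    exists y => //; apply/eqP; rewrite eqEdim dQ dim_vline P_neq0 // andbT QE -memvE.
    apply/vlineP; exists (c / N y); rewrite PE // scale_plane scalerA wE.
    suff <- : l = (c / N y)%:A * (h * (N y)%:A / den y) by [].
    have d0 : den y != 0 by exact: denominator_neq0.
    apply: (mulIf d0); rewrite mulrA divfK // [LHS]mulrBr mulrCA cE.
    by rewrite -[LHS]mulr_algl mulrCA mulrC -algM divfK ?N0.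
  split; last first.
    exists <[(y.1%:A : L) *: u + (y.2%:A : L) *: v]>%VS; first by exists y.
    split; first by rewrite dim_vline P_neq0.
    rewrite -memvE; apply/(field_reduction_line _ (free2_neq0 uv yn)).
    by exists (h * (N y)%:A / den y); rewrite PE.
  split; first by rewrite dim_vline P_neq0.
  rewrite -memvE [P y]combE; apply/HE.
  exists (\sum_(i < t.+1) p`_i * (y.1 ^+ (t - i) * y.2 ^+ i)).
  by rewrite -[RHS]mulr_algl; ring.
exists <<[tuple e i | i < t.+1]>>%VS; split.
- by move/eqnP: e_free => ->; rewrite size_tuple.
- rewrite CE; split=> [_ [y _ ->]|U UP].
    rewrite -memvE; apply: memv_suml => i _; rewrite memvZ // memv_span //.
    by apply/mapP; exists i; rewrite ?mem_enum.
  apply/span_subvP => _ /mapP[i _ ->].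
  apply: (rational_curve_spans tF (e := e)) => y yn.
  by rewrite memvE; apply: UP; exists y.
exists [tuple e i | i < t.+1]; first by rewrite /basis_of eqxx.
rewrite CE; congr [set Q | exists2 y, y != _ & Q = <[_]>%VS].
by apply/funext => _; apply/funext => y; apply: eq_bigr => i _; rewrite tnth_mktuple.
Qed.
End Curve.

(** * Independence of the frame *)

Section Frames.
Variables (F : finFieldType) (L : fieldExtType F).
Implicit Types (u v w : plane L) (a b z : L).

Lemma vline_scale (a : L) w : a != 0 -> <[a *: w]>%VS = <[w]>%VS.
Proof.
move=> a0; apply/eqP; rewrite eqEdim -memvE memvZ ?memv_line // !dim_vline.
by rewrite scaler_eq0 (negPf a0) leqnn.
Qed.

Lemma subline_through_sub u v u0 v0 (g : L) (a b c d : F) :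
  free [:: u; v] ->
  u = g *: ((a%:A : L) *: u0 + (b%:A : L) *: v0) ->
  v = g *: ((c%:A : L) *: u0 + (d%:A : L) *: v0) ->
  subline_through u v `<=` subline_through u0 v0.
Proof.
move=> uv uE vE _ [x xn ->]; have n0 := free2_neq0 uv xn.
have E : (x.1%:A : L) *: u + (x.2%:A : L) *: v =
    g *: (((x.1 * a + x.2 * c)%:A : L) *: u0 + ((x.1 * b + x.2 * d)%:A : L) *: v0).
  rewrite uE vE !scalerDr !scalerA addrACA -!scalerDl.
  by congr (_ *: _ + _ *: _); rewrite -!in_algE !rmorphD !rmorphM /=; ring.
rewrite {}E in n0 *.
have g0 : g != 0 by apply: contraNneq n0 => ->; rewrite scale0r.
exists (x.1 * a + x.2 * c, x.1 * b + x.2 * d); last by rewrite vline_scale.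
apply: contraNneq n0 => -[-> ->]; by rewrite !scale0r addr0 scaler0.
Qed.

Lemma vline_eq_scale u w : <[u]>%VS = <[w]>%VS -> exists a, u = a *: w.
Proof. by move=> uw; apply/vlineP; rewrite -uw memv_line. Qed.

(** Writing <u>, <v>, <u + v> in coordinates over F, the multipliers al, be, ga
satisfy a linear system over F; by Cramer's rule al and be are multiples of ga
by elements of F.  Up to the common factor ga, the change of frame is thus an
invertible matrix over F, and both inclusions follow. *)
Lemma subline_through_frame u0 v0 u v : free [:: u0; v0] -> free [:: u; v] ->
  subline_through u0 v0 <[u]>%VS -> subline_through u0 v0 <[v]>%VS ->
  subline_through u0 v0 <[u + v]>%VS ->
  subline_through u0 v0 = subline_through u v.
Proof.
move=> uv0 uv [[x1 x2] xn /vline_eq_scale[al uE]] [[y1 y2] yn /vline_eq_scale[be vE]].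
case=> [[w1 w2] _ /vline_eq_scale[ga wE]]; rewrite /= in uE vE wE.
have [e1 e2] : al * x1%:A + be * y1%:A = ga * w1%:A /\ al * x2%:A + be * y2%:A = ga * w2%:A.
  apply: (free2_inj uv0); rewrite !scalerDl -!scalerA addrACA -!scalerDr -uE -vE.
  exact: wE.
have algM (x y : F) : (x * y)%:A = x%:A * y%:A :> L by exact: (rmorphM (in_alg L)).
have algB (x y : F) : (x - y)%:A = x%:A - y%:A :> L by exact: (rmorphB (in_alg L)).
pose D := x1 * y2 - x2 * y1.
have lin (s s' : L) : s *: u + s' *: v =
   (s * al * x1%:A + s' * be * y1%:A) *: u0 + (s * al * x2%:A + s' * be * y2%:A) *: v0.
  rewrite uE vE !scalerDr !scalerA addrACA -!scalerDl.
  by congr (_ *: _ + _ *: _); rewrite !mulrA.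
have be0 : be != 0.
  apply: contraTneq uv => be0; apply/negP => /free2P/(_ 0 1).
  rewrite vE be0 !scale0r scaler0 addr0 => /(_ erefl)[_ /eqP]; by rewrite oner_eq0.
have al0 : al != 0.
  apply: contraTneq uv => al0; apply/negP => /free2P/(_ 1 0).
  rewrite uE al0 !scale0r scaler0 addr0 => /(_ erefl)[/eqP]; by rewrite oner_eq0.
have D0 : D != 0.
  apply: contra yn => /eqP D0; have : D%:A = 0 :> L by rewrite D0 scale0r.
  rewrite algB !algM => DA.
  have [] := free2P _ _ uv (be * y2%:A) (- (al * x2%:A)).
    rewrite lin (_ : _ + _ = al * be * (x1%:A * y2%:A - x2%:A * y1%:A)); last by ring.
    by rewrite DA mulr0 scale0r add0r (_ : _ + _ = 0) ?scale0r //; ring.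
  move=> /eqP + _; rewrite mulf_eq0 (negPf be0) scaler_eq0 oner_eq0 orbF /= => /eqP->.
  have [] := free2P _ _ uv (be * y1%:A) (- (al * x1%:A)).
    rewrite lin addrC (_ : _ + _ = - (al * be * (x1%:A * y2%:A - x2%:A * y1%:A))); last by ring.
    by rewrite DA mulr0 oppr0 scale0r add0r (_ : _ + _ = 0) ?scale0r //; ring.
  by move=> /eqP + _; rewrite mulf_eq0 (negPf be0) scaler_eq0 oner_eq0 orbF /= => /eqP->.
have A0 (x : F) : x != 0 -> x%:A != 0 :> L by rewrite scaler_eq0 oner_eq0 orbF.
pose r := (w1 * y2 - w2 * y1) / D; pose s := (x1 * w2 - x2 * w1) / D.
have alE : al = ga * r%:A.
  apply: (mulIf (A0 _ D0)); rewrite -mulrA -algM divfK // !algB !algM.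
  transitivity ((al * x1%:A + be * y1%:A) * y2%:A - (al * x2%:A + be * y2%:A) * y1%:A).
    by ring.
  by rewrite e1 e2; ring.
have beE : be = ga * s%:A.
  apply: (mulIf (A0 _ D0)); rewrite -mulrA -algM divfK // !algB !algM.
  transitivity (x1%:A * (al * x2%:A + be * y2%:A) - x2%:A * (al * x1%:A + be * y1%:A)).
    by ring.
  by rewrite e1 e2; ring.
have [ga0 r0 s0] : [/\ ga != 0, r != 0 & s != 0].
  split.
  - by apply: contraNneq al0 => g0; rewrite alE g0 mul0r.
  - by apply: contraNneq al0 => r0; rewrite alE r0 scale0r mulr0.
  - by apply: contraNneq be0 => s0; rewrite beE s0 scale0r mulr0.
clearbody r s; pose E := r * s * D.
have E0 : E != 0 by rewrite !mulf_neq0 ?D0.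
have algN (x : F) : (- x)%:A = - x%:A :> L by exact: (rmorphN (in_alg L)).
have EV : (E^-1)%:A * (r%:A * s%:A * (x1%:A * y2%:A - x2%:A * y1%:A)) = 1 :> L.
  by rewrite -!(algM, algB) mulVf // scale1r.
(* The coefficients of the first inclusion are those of the inverse matrix. *)
apply/seteqP; split.
  apply: (@subline_through_sub _ _ _ _ ga^-1 (s * y2 / E) (- (r * x2) / E)
      (- (s * y1) / E) (r * x1 / E)) => //.
  - apply: (scalerI ga0); rewrite scalerA divff // scale1r lin alE beE !(algM, algN).
    rewrite [X in X *: u0 + _](_ : _ = ga * ((E^-1)%:A *
      (r%:A * s%:A * (x1%:A * y2%:A - x2%:A * y1%:A)))); last by ring.
    rewrite EV mulr1 [X in _ + X *: v0](_ : _ = 0) ?scale0r ?addr0 //; ring.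
  - apply: (scalerI ga0); rewrite scalerA divff // scale1r lin alE beE !(algM, algN).
    rewrite [X in _ + X *: v0](_ : _ = ga * ((E^-1)%:A *
      (r%:A * s%:A * (x1%:A * y2%:A - x2%:A * y1%:A)))); last by ring.
    rewrite EV mulr1 [X in X *: u0 + _](_ : _ = 0) ?scale0r ?add0r //; ring.
apply: (@subline_through_sub _ _ _ _ ga (r * x1) (r * x2) (s * y1) (s * y2)) => //.
- by rewrite uE alE !scalerDr !scalerA !algM !mulrA.
- by rewrite vE beE !scalerDr !scalerA !algM !mulrA.
Qed.

End Frames.

Theorem theorem3p3 (q n : nat) (F : finFieldType) (L : fieldExtType F)
    (hq : #|F| = q) (hL : \dim {:L} = n) (hn : (2 <= n)%N)
    (b : set {vspace plane L}) (hb : subline b)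
    (Theta : {vspace plane L}) (hTheta : \dim Theta = 1%N) (hThetab : ~ b Theta)
    (H : {vspace reduced_space L}) (hH : \dim H = n.+1)
    (hThetaH : (field_reduction Theta <= H)%VS) :
  normal_rational_curve (minn q (degree_over Theta b))
    (points H `&` field_reduction_points b).
Proof.
subst q n; case: hb => u0 [v0 [uv0 bE]]; have {}bE : b = subline_through u0 v0 by [].
have line_mem u v (x : F * F) (P : {vspace plane L}) : x != (0, 0) ->
    P = <[(x.1%:A : L) *: u + (x.2%:A : L) *: v]>%VS -> subline_through u v P.
  by move=> xn PE; exists x.
have ne (x y : F) : (x != 0) || (y != 0) -> (x, y) != (0, 0) by rewrite xpair_eqE negb_and.
have /(xgetPex 0) : exists z, frame_coordinate b Theta z.
  have [a [c wE]] := free2_span (vpick Theta) uv0.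
  have w0 : vpick Theta != 0 by rewrite vpick0 -dimv_eq0 hTheta.
  have TE : Theta = <[vpick Theta]>%VS.
    by apply/esym/eqP; rewrite eqEdim -memvE memv_pick dim_vline w0 hTheta.
  have a0 : a != 0.
    apply: contra_not_neq hThetab => a0; rewrite bE.
    apply: (line_mem _ _ (0, 1)); first by rewrite ne // oner_eq0 orbT.
    rewrite {1}TE wE /= a0 !scale0r !add0r !scale1r vline_scale //.
    by apply: contraNneq w0 => c0; rewrite wE a0 c0 !scale0r addr0.
  exists (c / a), u0, v0; split=> //; rewrite ?bE.
  - by apply: (line_mem _ _ (1, 0)); rewrite ?ne ?oner_eq0 //= !scale1r !scale0r addr0.
  - by apply: (line_mem _ _ (0, 1)); rewrite ?ne ?oner_eq0 ?orbT //= !scale1r !scale0r add0r.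
  - by apply: (line_mem _ _ (1, 1)); rewrite ?ne ?oner_eq0 //= !scale1r.
  - by rewrite {1}TE wE -[RHS](vline_scale _ a0) scalerDr scalerA [a * _]mulrC divfK.
(* From here on the frame is the one chosen by the degree, not u0, v0. *)
rewrite /degree_over asboolF //; set z := xget _ _.
case=> u [v [uv bu bv buv ThetaE]].
have {}bE : b = subline_through u v.
  by rewrite bE in bu bv buv *; apply: subline_through_frame.
have zF : z \notin 1%VS.
  apply/negP => /vlineP[c zE]; apply: hThetab; rewrite bE.
  apply: (line_mem _ _ (1, c)); first by rewrite ne ?oner_eq0.
  by rewrite /= scale1r scale1r -zE.
rewrite ThetaE in hThetaH; have [h h0 HE] := section_equation uv hH hThetaH.
by rewrite bE; apply: section_rational HE.
Qed.
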